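(* Let $\mathbb{F}$ be a field. For every integer $n \geq 2$, the variety $\mathbf{Sol}_n(\mathbf{Lie})$ of Lie algebras over $\mathbb{F}$ that are solvable of derived length at most $n$ (regarded as a category, with all Lie algebra homomorphisms as morphisms) is not weakly action representable.
   Context: For a Lie algebra $L$ over $\mathbb{F}$, the derived series is $L^{(0)} = L$, $L^{(j)} = [L^{(j-1)}, L^{(j-1)}]$ for $j\ge 1$. $L$ is said to be $t$-solvable if $L^{(t-1)}\neq 0$ and $L^{(t)}=0$. $\mathbf{Sol}_n(\mathbf{Lie})$ is the full subcategory of the category of Lie algebras over $\mathbb{F}$ consisting of all Lie algebras that are $t$-solvable for some $t \leq n$, i.e. those with $L^{(n)} = 0$ (including the zero algebra). Let $\mathcal{C}$ be a semi-abelian category (every variety of Lie algebras is one). For objects $B, X$ of $\mathcal{C}$, a split extension of $B$ by $X$ is a diagram $X \xrightarrow{\,\kappa\,} A \overset{\alpha}{\underset{\beta}{\rightleftarrows}} B$ in $\mathcal{C}$ (with $\alpha\colon A \to B$, $\beta \colon B \to A$) such that $\alpha\circ\beta = \mathrm{id}_B$ and $(X,\kappa)$ is a kernel of $\alpha$. Two split extensions $(A,\kappa,\alpha,\beta)$ and $(A',\kappa',\alpha',\beta')$ of $B$ by $X$ are isomorphic if there is an isomorphism $\theta\colon A \to A'$ with $\theta\kappa = \kappa'$, $\alpha'\theta = \alpha$ and $\theta\beta = \beta'$. For a fixed object $X$, the functor $\mathrm{SplExt}(-,X)\colon \mathcal{C}^{op}\to \mathbf{Set}$ sends $B$ to the set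 of isomorphism classes of split extensions (in $\mathcal{C}$) of $B$ by $X$, and sends $f\colon B'\to B$ to the map $f^*\colon \mathrm{SplExt}(B,X)\to \mathrm{SplExt}(B',X)$ given by pulling back along $f$. The category $\mathcal{C}$ is weakly action representable if for every object $X$ of $\mathcal{C}$ there exist an object $T = T(X)$ of $\mathcal{C}$ and a natural monomorphism of functors (a natural transformation with all components injective) $\tau\colon \mathrm{SplExt}(-,X) \rightarrowtail \mathrm{Hom}_{\mathcal{C}}(-,T)$. *)

(* Defs.v *)
From HB Require Import structures.
From mathcomp Require Import all_boot all_order all_algebra.
From mathcomp Require Import boolp.

Set Implicit Arguments.
Unset Strict Implicit.
Unset Printing Implicit Defensive.

Import GRing.Theory.

Declare Scope cat_scope.
Delimit Scope cat_scope with cat.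
Reserved Notation "g \oc f" (at level 50, left associativity).

Record category := Category {
  obj :> Type;
  hom : obj -> obj -> Type;
  idc : forall A, hom A A;
  compc : forall A B D, hom B D -> hom A B -> hom A D;
  compcA : forall A B D E (h : hom D E) (g : hom B D) (f : hom A B),
    compc h (compc g f) = compc (compc h g) f;
  comp1c : forall A B (f : hom A B), compc (idc B) f = f;
  compc1 : forall A B (f : hom A B), compc f (idc A) = f }.

Arguments hom {c} A B.
Arguments idc {c} A.
Notation "g \oc f" := (compc g f) : cat_scope.
Local Open Scope cat_scope.

Definition full_subcategory (C : category) (P : C -> Prop) : category :=
  @Category {A : C | P A} (fun A B => hom (sval A) (sval B))
    (fun A => idc (sval A)) (fun _ _ _ g f => g \oc f)
    (fun _ _ _ _ h g f => compcA h g f)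
    (fun _ _ f => comp1c f) (fun _ _ f => compc1 f).

Section CategoryNotions.
Variable C : category.
Implicit Types A B D K P W X Z : C.

Definition is_iso A B (f : hom A B) :=
  exists g : hom B A, g \oc f = idc A /\ f \oc g = idc B.

Definition is_zero_object Z :=
  forall A, (exists! _ : hom A Z, True) /\ (exists! _ : hom Z A, True).

Definition is_zero_morphism A B (f : hom A B) :=
  exists Z (u : hom A Z) (v : hom Z B), is_zero_object Z /\ f = v \oc u.

Definition is_kernel K A B (k : hom K A) (f : hom A B) :=
  is_zero_morphism (f \oc k) /\
  forall W (g : hom W A), is_zero_morphism (f \oc g) ->
    exists! h : hom W K, k \oc h = g.

Definition is_pullback A B D P (f : hom A B) (g : hom D B)
    (p : hom P A) (q : hom P D) :=
  f \oc p = g \oc q /\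
  forall W (u : hom W A) (v : hom W D), f \oc u = g \oc v ->
    exists! h : hom W P, p \oc h = u /\ q \oc h = v.

Definition has_pullbacks :=
  forall A B D (f : hom A B) (g : hom D B),
    exists P (p : hom P A) (q : hom P D), is_pullback f g p q.

Record split_ext B X := SplitExt {
  se_obj : C;
  se_ker : hom X se_obj;
  se_epi : hom se_obj B;
  se_sec : hom B se_obj;
  se_epiK : se_epi \oc se_sec = idc B;
  se_kerP : is_kernel se_ker se_epi }.

Definition split_ext_iso B X (E E' : split_ext B X) :=
  exists t : hom (se_obj E) (se_obj E'),
    [/\ is_iso t, t \oc se_ker E = se_ker E',
        se_epi E' \oc t = se_epi E & t \oc se_sec E = se_sec E'].

(* [E'] is, up to the choice of the pullback object, the split extension
   X --(k,0)--> A x_B B' <==> B' obtained from [E] by pulling back along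
   [f]; [p] is the projection onto A and [se_epi E'] the one onto B'. *)
Definition is_pullback_split_ext B B' X (f : hom B' B)
    (E : split_ext B X) (E' : split_ext B' X) :=
  exists p : hom (se_obj E') (se_obj E),
    [/\ is_pullback (se_epi E) f p (se_epi E'),
        p \oc se_ker E' = se_ker E & p \oc se_sec E' = se_sec E \oc f].

(* Plain predicates rather than [set]: the universe of [set] in the analysis
   library lies below that of the carrier types. *)
Definition SplExt B X :=
  {c : split_ext B X -> Prop | exists E, c = split_ext_iso E}.

Definition SplExt_class B X (E : split_ext B X) : SplExt B X :=
  exist _ (split_ext_iso E) (ex_intro _ E erefl).

Lemma split_ext_iso_refl B X (E : split_ext B X) : split_ext_iso E E.
Proof.
exists (idc _); split; rewrite ?comp1c ?compc1 //.
by exists (idc _); rewrite comp1c.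
Qed.

Lemma split_ext_iso_sym B X (E E' : split_ext B X) :
  split_ext_iso E E' -> split_ext_iso E' E.
Proof.
move=> [t [[s [st ts]] tk et tb]]; exists s; split.
- by exists t.
- by rewrite -tk compcA st comp1c.
- by rewrite -et -compcA ts compc1.
- by rewrite -tb compcA st comp1c.
Qed.

Lemma split_ext_iso_trans B X (E E' E'' : split_ext B X) :
  split_ext_iso E E' -> split_ext_iso E' E'' -> split_ext_iso E E''.
Proof.
move=> [t [[s [st ts]] tk et tb]] [t' [[s' [st' ts']] tk' et' tb']].
exists (t' \oc t); split.
- exists (s \oc s'); split.
    by rewrite -compcA (compcA s') st' comp1c.
  by rewrite -compcA (compcA t) ts comp1c.
- by rewrite -compcA tk.
- by rewrite compcA et'.
- by rewrite -compcA tb.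
Qed.

Lemma SplExt_classP B X (E E' : split_ext B X) :
  SplExt_class E = SplExt_class E' <-> split_ext_iso E E'.
Proof.
split=> [/(congr1 sval) /= ->|EE']; first exact: split_ext_iso_refl.
apply: eq_exist; apply: funext => D; apply: propext; split.
  exact/split_ext_iso_trans/split_ext_iso_sym.
exact: split_ext_iso_trans.
Qed.

Lemma zero_morphism_uniq A B (f g : hom A B) :
  is_zero_morphism f -> is_zero_morphism g -> f = g.
Proof.
move=> [Z [u [v [Z0 ->]]]] [Z' [u' [v' [Z0' ->]]]].
have [_ [w _]] := Z0 Z'.
have [[? [_ hu]] _] := Z0' A; have [_ [? [_ hv]]] := Z0 B.
have -> : u' = w \oc u by rewrite -(hu u') // -(hu (w \oc u)).
by rewrite compcA -(hv v) // -(hv (v' \oc w)).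
Qed.

Lemma zero_morphism_compl A B D (f : hom A B) (g : hom B D) :
  is_zero_morphism f -> is_zero_morphism (g \oc f).
Proof. by move=> [Z [u [v [Z0 ->]]]]; exists Z, u, (g \oc v); rewrite compcA. Qed.

Lemma zero_morphism_compr A B D (f : hom A B) (g : hom B D) :
  is_zero_morphism g -> is_zero_morphism (g \oc f).
Proof. by move=> [Z [u [v [Z0 ->]]]]; exists Z, (u \oc f), v; rewrite compcA. Qed.

Lemma pullback_split_ext_exists (pb : has_pullbacks) B B' X (f : hom B' B)
    (E : split_ext B X) :
  exists E' : split_ext B' X, is_pullback_split_ext f E E'.
Proof.
case: E => A k a b ab kP.
have [P [p [q pq]]] := pb _ _ _ a f; have [apfq univ] := pq.
have uniqP W (h h' : hom W P) : p \oc h = p \oc h' -> q \oc h = q \oc h' -> h = h'.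
  move=> ph qh; have [|l [_ lu]] := univ _ (p \oc h') (q \oc h').
    by rewrite !compcA apfq.
  by rewrite -(lu h) // -(lu h').
have [[Z [u [v [Z0 akE]]]] kuniv] := kP.
have [_ [w [_ _]]] := Z0 B'.
have z0 : is_zero_morphism (w \oc u) by exists Z, u, w.
have [|k' [[pk' qk'] _]] := univ X k (w \oc u).
  apply: zero_morphism_uniq; first by case: kP.
  exact: zero_morphism_compl.
have [|b' [[pb' qb'] _]] := univ B' (b \oc f) (idc B').
  by rewrite compcA ab comp1c compc1.
have kP' : is_kernel k' q.
  split=> [|W g qg0]; first by rewrite qk'.
  have [|h [kh hu]] := kuniv W (p \oc g).
    by rewrite compcA apfq -compcA; apply: zero_morphism_compl.
  exists h; split.
    apply: uniqP; first by rewrite compcA pk'.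
    rewrite compcA qk'; apply: zero_morphism_uniq qg0.
    exact: zero_morphism_compr.
  by move=> h' k'h'; apply: hu; rewrite -k'h' compcA pk'.
by exists (SplitExt qb' kP'), p.
Qed.

Lemma pullback_split_ext_iso B B' X (f : hom B' B)
    (E1 E2 : split_ext B X) (E1' E2' : split_ext B' X) :
  split_ext_iso E1 E2 ->
  is_pullback_split_ext f E1 E1' -> is_pullback_split_ext f E2 E2' ->
  split_ext_iso E1' E2'.
Proof.
move=> [t [[s [st ts]] tk et tb]] [p1 [[sq1 u1] pk1 pb1]] [p2 [[sq2 u2] pk2 pb2]].
have [_ sk es sb] : [/\ True, s \oc se_ker E2 = se_ker E1,
    se_epi E1 \oc s = se_epi E2 & s \oc se_sec E2 = se_sec E1].
  split=> //.
  - by rewrite -tk compcA st comp1c.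
  - by rewrite -et -compcA ts compc1.
  - by rewrite -tb compcA st comp1c.
have uniq1 W (h h' : hom W (se_obj E1')) :
    p1 \oc h = p1 \oc h' -> se_epi E1' \oc h = se_epi E1' \oc h' -> h = h'.
  move=> ph qh; have [|l [_ lu]] := u1 _ (p1 \oc h') (se_epi E1' \oc h').
    by rewrite !compcA sq1.
  by rewrite -(lu h) // -(lu h').
have uniq2 W (h h' : hom W (se_obj E2')) :
    p2 \oc h = p2 \oc h' -> se_epi E2' \oc h = se_epi E2' \oc h' -> h = h'.
  move=> ph qh; have [|l [_ lu]] := u2 _ (p2 \oc h') (se_epi E2' \oc h').
    by rewrite !compcA sq2.
  by rewrite -(lu h) // -(lu h').
have [|m [[pm qm] _]] := u2 _ (t \oc p1) (se_epi E1').
  by rewrite compcA et.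
have [|m' [[pm' qm'] _]] := u1 _ (s \oc p2) (se_epi E2').
  by rewrite compcA es.
exists m; split=> //.
- exists m'; split; [apply: uniq1|apply: uniq2]; rewrite compcA compc1.
  + by rewrite pm' -compcA pm compcA st comp1c.
  + by rewrite qm'.
  + by rewrite pm -compcA pm' compcA ts comp1c.
  + by rewrite qm.
- apply: uniq2; first by rewrite compcA pm -compcA pk1 tk pk2.
  rewrite compcA qm; apply: zero_morphism_uniq.
    by case: (se_kerP E1').
  by case: (se_kerP E2').
- apply: uniq2; first by rewrite compcA pm -compcA pb1 compcA tb pb2.
  by rewrite compcA qm !se_epiK.
Qed.

Lemma pullback_split_ext_isor B B' X (f : hom B' B)
    (E : split_ext B X) (E1 E2 : split_ext B' X) :
  split_ext_iso E1 E2 ->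
  is_pullback_split_ext f E E1 -> is_pullback_split_ext f E E2.
Proof.
move=> /split_ext_iso_sym [s [[t [ts st]] sk es sb]] [p [[sq u] pk pb]].
exists (p \oc s); split; last by rewrite -compcA sb.
- split=> [|W g h gh]; first by rewrite compcA sq -compcA es.
  have [l [[pl ql] lu]] := u _ _ _ gh.
  exists (t \oc l); split.
    split; first by rewrite compcA -(compcA p) st compc1.
    by rewrite -es compcA -(compcA (se_epi E1)) st compc1.
  move=> l' [pl' ql'].
  rewrite (lu (s \oc l')) ?compcA ?ts ?comp1c //.
  by rewrite es.
- by rewrite -compcA sk.
Qed.

Definition SplExt_pull_class B B' X (f : hom B' B) (c : SplExt B X) :
    split_ext B' X -> Prop :=
  fun E' => exists E, sval c E /\ is_pullback_split_ext f E E'.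

Lemma SplExt_pull_subproof (pb : has_pullbacks) B B' X (f : hom B' B)
    (c : SplExt B X) :
  exists E', SplExt_pull_class f c = split_ext_iso E'.
Proof.
case: c => c [E cE]; have [E' EE'] := pullback_split_ext_exists pb f E.
rewrite /SplExt_pull_class /= cE; exists E'; apply: funext => D; apply: propext; split.
  by move=> [E1 [/= EE1 E1D]]; apply: pullback_split_ext_iso EE1 EE' E1D.
move=> E'D; exists E; split; first exact: split_ext_iso_refl.
exact: pullback_split_ext_isor E'D EE'.
Qed.

Definition SplExt_pull (pb : has_pullbacks) B B' X (f : hom B' B)
    (c : SplExt B X) : SplExt B' X :=
  exist _ (SplExt_pull_class f c) (SplExt_pull_subproof pb f c).

Lemma SplExt_pullE (pb : has_pullbacks) B B' X (f : hom B' B)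
    (E : split_ext B X) (E' : split_ext B' X) :
  is_pullback_split_ext f E E' ->
  SplExt_pull pb f (SplExt_class E) = SplExt_class E'.
Proof.
move=> EE'; apply: eq_exist; apply: funext => D; apply: propext; split.
  by move=> [E1 [/= EE1 E1D]]; apply: pullback_split_ext_iso EE1 EE' E1D.
move=> E'D; exists E; split; first exact: split_ext_iso_refl.
exact: pullback_split_ext_isor E'D EE'.
Qed.

Definition weakly_action_representable (pb : has_pullbacks) :=
  forall X, exists (T : C) (tau : forall B, SplExt B X -> hom B T),
    (forall B B' (f : hom B' B) (c : SplExt B X),
        tau B' (SplExt_pull pb f c) = tau B c \oc f) /\
    (forall B, injective (tau B)).

End CategoryNotions.

Arguments weakly_action_representable : clear implicits.

Local Open Scope ring_scope.

HB.mixin Record Lmodule_isLieAlgebra (F : fieldType) L of GRing.Lmodule F L := {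
  lie : L -> L -> L;
  lie_linearl : forall y, linear (lie^~ y);
  lie_linearr : forall x, linear (lie x);
  lievv : forall x, lie x x = 0;
  lie_jacobi : forall x y z,
    lie x (lie y z) + lie y (lie z x) + lie z (lie x y) = 0 }.

#[short(type="lieAlgType")]
HB.structure Definition LieAlgebra (F : fieldType) :=
  {L of GRing.Lmodule F L & Lmodule_isLieAlgebra F L}.

Arguments lie {F s}.

Record lie_hom (F : fieldType) (L M : lieAlgType F) := LieHom {
  lie_hom_fun :> L -> M;
  lie_hom_linear : linear lie_hom_fun;
  lie_homM : {morph lie_hom_fun : x y / lie x y} }.

HB.instance Definition _ (F : fieldType) (L M : lieAlgType F) (f : lie_hom L M) :=
  GRing.isLinear.Build F L M *:%R (lie_hom_fun f) (lie_hom_linear f).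

Section LieCategory.
Variable F : fieldType.
Implicit Types L M N : lieAlgType F.

Lemma lie_homP L M (f g : lie_hom L M) : f =1 g -> f = g.
Proof.
case: f g => f fl fm [g gl gm] /= /funext fg; case: _ / fg in gl gm *.
by congr LieHom; apply: Prop_irrelevance.
Qed.

Definition lie_id L : lie_hom L L :=
  @LieHom F L L id (fun _ _ _ => erefl) (fun _ _ => erefl).

Lemma lie_comp_linear L M N (g : lie_hom M N) (f : lie_hom L M) :
  linear (g \o f).
Proof. by move=> a x y /=; rewrite !linearP. Qed.

Lemma lie_comp_lie L M N (g : lie_hom M N) (f : lie_hom L M) :
  {morph g \o f : x y / lie x y}.
Proof. by move=> x y /=; rewrite !lie_homM. Qed.

Definition lie_comp L M N (g : lie_hom M N) (f : lie_hom L M) : lie_hom L N :=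
  LieHom (lie_comp_linear g f) (lie_comp_lie g f).

Lemma lie_compA L M N N' (h : lie_hom N N') (g : lie_hom M N) (f : lie_hom L M) :
  lie_comp h (lie_comp g f) = lie_comp (lie_comp h g) f.
Proof. exact: lie_homP. Qed.

Lemma lie_comp1l L M (f : lie_hom L M) : lie_comp (lie_id M) f = f.
Proof. exact: lie_homP. Qed.

Lemma lie_compl1 L M (f : lie_hom L M) : lie_comp f (lie_id L) = f.
Proof. exact: lie_homP. Qed.

Definition Lie : category := Category lie_compA lie_comp1l lie_compl1.

(* The linear span of the brackets [S, S]. *)
Inductive lie_commutator L (S : L -> Prop) : L -> Prop :=
| LieCommutator0 : lie_commutator S 0
| LieCommutatorD (a : F) (x y z : L) : S x -> S y -> lie_commutator S z ->
    lie_commutator S (a *: lie x y + z).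

Definition derived_series L (j : nat) : L -> Prop :=
  iter j (@lie_commutator L) (fun=> True).

Definition solvable_le (n : nat) L : Prop :=
  forall x : L, derived_series n x -> x = 0.

Definition Sol (n : nat) : category := full_subcategory (solvable_le n : Lie -> Prop).

Lemma lie_hom_derived L M (f : lie_hom L M) j x :
  derived_series j x -> derived_series j (f x).
Proof.
elim: j x => [//|j IH] x /=; elim=> [|a y z t dy dz _ dt].
  by rewrite linear0; constructor.
by rewrite lie_hom_linear lie_homM; constructor=> //; apply: IH.
Qed.

End LieCategory.

Section LiePullback.
Variables (F : fieldType) (A B D : lieAlgType F).
Variables (f : lie_hom A B) (g : lie_hom D B).

Definition pb_pred : {pred A * D} := fun x => f x.1 == g x.2.

Lemma pb_submod_closed : submod_closed pb_pred.
Proof.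
split=> [|a x y]; rewrite !unfold_in /=; first by rewrite !linear0.
move=> /eqP xE /eqP yE; change (f (a *: x.1 + y.1) == g (a *: x.2 + y.2)).
by rewrite !lie_hom_linear xE yE.
Qed.

HB.instance Definition _ :=
  GRing.isSubmodClosed.Build F (A * D)%type pb_pred pb_submod_closed.

Record lie_pullback := LiePullback {
  lie_pullback_val :> A * D;
  lie_pullbackP : lie_pullback_val \in pb_pred }.

HB.instance Definition _ := [isSub for lie_pullback_val].
HB.instance Definition _ := [Choice of lie_pullback by <:].
HB.instance Definition _ := [SubChoice_isSubLmodule of lie_pullback by <:].

Lemma pb_lie_subproof (x y : lie_pullback) :
  (lie (val x).1 (val y).1, lie (val x).2 (val y).2) \in pb_pred.
Proof.
rewrite unfold_in /= !lie_homM.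
by case: x y => [x /= /eqP->] [y /= /eqP->].
Qed.

Definition pb_lie (x y : lie_pullback) : lie_pullback :=
  LiePullback (pb_lie_subproof x y).

Lemma pb_lie_linearl y : linear (pb_lie^~ y).
Proof. by move=> a u v; apply: val_inj; congr pair; apply: lie_linearl. Qed.

Lemma pb_lie_linearr x : linear (pb_lie x).
Proof. by move=> a u v; apply: val_inj; congr pair; apply: lie_linearr. Qed.

Lemma pb_lievv x : pb_lie x x = 0.
Proof. by apply: val_inj; congr pair; apply: lievv. Qed.

Lemma pb_lie_jacobi x y z :
  pb_lie x (pb_lie y z) + pb_lie y (pb_lie z x) + pb_lie z (pb_lie x y) = 0.
Proof. by apply: val_inj; congr pair; apply: lie_jacobi. Qed.

HB.instance Definition _ := Lmodule_isLieAlgebra.Build F lie_pullback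
  pb_lie_linearl pb_lie_linearr pb_lievv pb_lie_jacobi.

Definition pb_fst : lie_hom lie_pullback A :=
  @LieHom F lie_pullback A (fun x => (val x).1)
    (fun _ _ _ => erefl) (fun _ _ => erefl).

Definition pb_snd : lie_hom lie_pullback D :=
  @LieHom F lie_pullback D (fun x => (val x).2)
    (fun _ _ _ => erefl) (fun _ _ => erefl).

Lemma solvable_pullback n :
  solvable_le n A -> solvable_le n D -> solvable_le n lie_pullback.
Proof.
move=> sA sD x dx; apply: val_inj; rewrite [val x]surjective_pairing.
congr pair; first exact/sA/(lie_hom_derived pb_fst).
exact/sD/(lie_hom_derived pb_snd).
Qed.

Lemma pb_univ (W : lieAlgType F) (u : lie_hom W A) (v : lie_hom W D) :
  lie_comp f u = lie_comp g v ->
  exists! h : lie_hom W lie_pullback, lie_comp pb_fst h = u /\ lie_comp pb_snd h = v.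
Proof.
move=> fugv.
have hP w : (u w, v w) \in pb_pred.
  have fgw : f (u w) = g (v w) := congr1 (fun h : lie_hom W B => h w) fugv.
  by rewrite unfold_in /= fgw.
have hl : linear (fun w => LiePullback (hP w)).
  by move=> a x y; apply: val_inj; congr pair; apply: lie_hom_linear.
have hm : {morph (fun w => LiePullback (hP w)) : x y / lie x y}.
  by move=> x y; apply: val_inj; congr pair; apply: lie_homM.
exists (LieHom hl hm); split.
  by split; apply: lie_homP.
move=> h [hu hv]; apply: lie_homP => w; apply: val_inj => /=.
by rewrite -hu -hv -surjective_pairing.
Qed.

End LiePullback.

Lemma Sol_has_pullbacks (F : fieldType) (n : nat) : has_pullbacks (Sol F n).
Proof.
move=> [A sA] [B sB] [D sD] f g.
exists (exist _ (lie_pullback f g : lieAlgType F) (solvable_pullback sA sD)).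
exists (pb_fst f g), (pb_snd f g); split.
  by apply: lie_homP => x /=; apply/eqP; exact: lie_pullbackP x.
by move=> W u v; apply: pb_univ.
Qed.

Arguments Sol_has_pullbacks : clear implicits.

(* Main.v *)
(** On an abelian Lie algebra [X = F^N], each elementary matrix [e_ij] defines
    an action of the one-dimensional Lie algebra, hence an element [psi i j] of
    a weak representing object [T], nonzero because [tau] is injective.  For
    distinct [i], [j], [k] the matrices [e_ij], [e_jk], [e_ik] span a
    Heisenberg algebra whose semidirect product with [X] is still metabelian,
    so naturality forces [[psi i j, psi j k] = psi i k] in [T].  Iterated
    halving puts [psi i (i + 2^m)] in the [m]-th derived algebra of [T] for
    all [m], so [T] cannot be solvable of derived length [n] once [2^n < N]. *)
From Pilot Require Import Defs.
From HB Require Import structures.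
From mathcomp Require Import all_boot all_order all_algebra.
From mathcomp Require Import ssrAC ring zify.
(* [all_algebra] shadows [hom]. *)
Import Pilot.Defs.

Set Implicit Arguments.
Unset Strict Implicit.
Unset Printing Implicit Defensive.

Import GRing.Theory.
Local Open Scope ring_scope.
Local Open Scope cat_scope.

(** * Preliminaries on Jacobi sums, brackets and solvability *)

(** The letters stand for the six ordered triple products in an expanded Jacobi sum. Both the matrix
    commutator and the vector part of a semidirect product expand to this pattern. *)
Lemma jacobi_terms (V : zmodType) (a b c d e f : V) :
  (a - b - (c - d)) + (c - e - (f - b)) + (f - d - (a - e)) = 0.
Proof.
rewrite !opprB !addrA.
rewrite [LHS](ACl ((1*12)*(7*2)*(3*10)*(5*4)*(11*6)*(9*8))%AC) /=.
by rewrite !subrr !addr0.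
Qed.

Lemma lie0l (F : fieldType) (L : lieAlgType F) (x : L) : lie 0 x = 0.
Proof.
have := lie_linearl x 1 0 0; rewrite !scale1r addr0.
by move/(congr1 (+%R^~ (- lie 0 x))); rewrite subrr addrK.
Qed.

Lemma lie0r (F : fieldType) (L : lieAlgType F) (x : L) : lie x 0 = 0.
Proof.
have := lie_linearr x 1 0 0; rewrite !scale1r addr0.
by move/(congr1 (+%R^~ (- lie x 0))); rewrite subrr addrK.
Qed.

Lemma lie_commutator_lie (F : fieldType) (L : lieAlgType F) (S : L -> Prop) (x y : L) :
  S x -> S y -> lie_commutator S (lie x y).
Proof.
move=> Sx Sy; rewrite -[lie x y]addr0 -[lie x y]scale1r.
by constructor=> //; constructor.
Qed.

Lemma lie_commutator_sub (F : fieldType) (L : lieAlgType F) (S P : L -> Prop) :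
  P 0 -> (forall a x y, P x -> P y -> P (a *: x + y)) ->
  (forall x y, S x -> S y -> P (lie x y)) ->
  forall x, lie_commutator S x -> P x.
Proof. by move=> P0 Plin Plie x; elim=> // a y z t Sy Sz _; apply/Plin/Plie. Qed.

Lemma solvable_leS (F : fieldType) (L : lieAlgType F) m :
  solvable_le m L -> solvable_le m.+1 L.
Proof.
move=> sL; apply: lie_commutator_sub => // [a x y -> ->|x y /sL -> _].
  by rewrite scaler0 addr0.
exact: lie0l.
Qed.

Lemma solvable_le_leq (F : fieldType) (L : lieAlgType F) m k :
  (m <= k)%N -> solvable_le m L -> solvable_le k L.
Proof.
move=> /subnK <-; elim: (k - m)%N => // d IH sL.
exact/solvable_leS/IH.
Qed.

(** * Abelian Lie algebras *)

Section Abelian.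
Variables (F : fieldType) (V : lmodType F).

Definition abelian_lie : Type := V.
HB.instance Definition _ := GRing.Lmodule.on abelian_lie.

Let zero_lie (x y : abelian_lie) : abelian_lie := 0.

Let zero_lie_linearl y : linear (zero_lie^~ y).
Proof. by move=> a u v; rewrite /zero_lie scaler0 addr0. Qed.

Let zero_lie_linearr x : linear (zero_lie x).
Proof. by move=> a u v; rewrite /zero_lie scaler0 addr0. Qed.

Let zero_lie_jacobi x y z :
  zero_lie x (zero_lie y z) + zero_lie y (zero_lie z x) + zero_lie z (zero_lie x y) = 0.
Proof. by rewrite /zero_lie !addr0. Qed.

HB.instance Definition _ := Lmodule_isLieAlgebra.Build F abelian_lie
  zero_lie_linearl zero_lie_linearr (fun _ => erefl) zero_lie_jacobi.

Lemma abelian_lieE (x y : abelian_lie) : lie x y = 0.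
Proof. by []. Qed.

Lemma solvable_abelian : solvable_le 1 abelian_lie.
Proof.
apply: lie_commutator_sub => // a x y -> ->.
by rewrite scaler0 addr0.
Qed.
End Abelian.

(** * The Lie algebra of square matrices *)

Section MatrixLie.
Variables (F : fieldType) (N : nat).

Let mx_lie (A B : 'M[F]_N) := A *m B - B *m A.

Let mx_lie_linearl B : linear (mx_lie^~ B).
Proof.
move=> a u v; rewrite /mx_lie mulmxDl mulmxDr -scalemxAl -scalemxAr scalerBr.
by rewrite opprD addrACA.
Qed.

Let mx_lie_linearr A : linear (mx_lie A).
Proof.
move=> a u v; rewrite /mx_lie mulmxDl mulmxDr -scalemxAl -scalemxAr scalerBr.
by rewrite opprD addrACA.
Qed.

Let mx_lievv A : mx_lie A A = 0.
Proof. exact: subrr. Qed.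

Let mx_lie_jacobi A B D :
  mx_lie A (mx_lie B D) + mx_lie B (mx_lie D A) + mx_lie D (mx_lie A B) = 0.
Proof.
rewrite /mx_lie !mulmxBl !mulmxBr !mulmxA.
exact: jacobi_terms.
Qed.

HB.instance Definition _ := Lmodule_isLieAlgebra.Build F 'M[F]_N
  mx_lie_linearl mx_lie_linearr mx_lievv mx_lie_jacobi.

Lemma mx_lieE (A B : 'M[F]_N) : lie A B = A *m B - B *m A.
Proof. by []. Qed.
End MatrixLie.

(* [rho] is a phantom parameter: it selects the bracket on the carrier. *)
Definition semidirect (F : fieldType) (N : nat) (B : lieAlgType F)
  (rho : lie_hom B 'M[F]_N) : Type := (B * 'cV[F]_N)%type.

(** * Semidirect products with a column space *)

Section Semidirect.
Variables (F : fieldType) (N : nat) (B : lieAlgType F) (rho : lie_hom B 'M[F]_N).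

Local Notation semidirect := (semidirect rho).
HB.instance Definition _ := GRing.Lmodule.copy semidirect (B * 'cV[F]_N)%type.

Let sd_lie (x y : semidirect) : semidirect :=
  (lie x.1 y.1, rho x.1 *m y.2 - rho y.1 *m x.2).

Let sd_lie_linearl y : linear (sd_lie^~ y).
Proof.
move=> a u v; congr pair; first exact: lie_linearl.
rewrite /= lie_hom_linear mulmxDl mulmxDr -scalemxAl -scalemxAr scalerBr.
by rewrite opprD addrACA.
Qed.

Let sd_lie_linearr x : linear (sd_lie x).
Proof.
move=> a u v; congr pair; first exact: lie_linearr.
rewrite /= lie_hom_linear mulmxDl mulmxDr -scalemxAl -scalemxAr scalerBr.
by rewrite opprD addrACA.
Qed.

Let sd_lievv x : sd_lie x x = 0.
Proof. by congr pair; [apply: lievv | apply: subrr]. Qed.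

Let sd_lie_jacobi x y z :
  sd_lie x (sd_lie y z) + sd_lie y (sd_lie z x) + sd_lie z (sd_lie x y) = 0.
Proof.
congr pair; first exact: lie_jacobi.
rewrite /= !lie_homM !mx_lieE !mulmxBl !mulmxBr !mulmxA.
exact: jacobi_terms.
Qed.

HB.instance Definition _ := Lmodule_isLieAlgebra.Build F semidirect
  sd_lie_linearl sd_lie_linearr sd_lievv sd_lie_jacobi.

Lemma sd_lieE (x y : semidirect) :
  lie x y = (lie x.1 y.1, rho x.1 *m y.2 - rho y.1 *m x.2) :> semidirect.
Proof. by []. Qed.

(** Any two elements of the derived algebra commute: their base parts are central, and the image of
    each base part under [rho] annihilates the vector part of the other. *)
Lemma solvable_semidirect :
  (forall x y z : B, lie (lie x y) z = 0) ->
  (forall x y z : B, rho (lie x y) *m rho z = 0) ->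
  solvable_le 2 semidirect.
Proof.
move=> nilB rhoB.
pose kills b := forall z, rho b *m rho z = 0.
(* [P] describes the derived algebra. Its last clause holds because vector parts there are
   combinations of vectors [rho c *m v], which [rho b] annihilates whenever [kills b]. *)
pose P (e : semidirect) := [/\ forall z, lie e.1 z = 0, kills e.1 &
  forall b, kills b -> rho b *m e.2 = 0].
have derP (e : semidirect) : lie_commutator (fun=> True) e -> P e.
  apply: lie_commutator_sub e => [|a x y [cx kx vx] [cy ky vy]|x y _ _].
  - split=> [z|z|b _]; rewrite /= ?lie0l ?linear0 ?mul0mx ?mulmx0 //.
  - split=> [z|z|b kb] /=.
    + by rewrite lie_linearl cx cy scaler0 addr0.
    + by rewrite lie_hom_linear mulmxDl -scalemxAl kx ky scaler0 addr0.
    + by rewrite mulmxDr -scalemxAr vx // vy // scaler0 addr0.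
  - split=> [z|z|b kb] /=; [exact: nilB|exact: rhoB|].
    by rewrite mulmxBr !mulmxA !kb !mul0mx subrr.
apply: lie_commutator_sub => // [a x y -> ->|x y /derP[cx kx vx] /derP[cy ky vy]].
  by rewrite scaler0 addr0.
by rewrite sd_lieE cx vx // vy // subrr.
Qed.

Definition sd_inj : lie_hom (abelian_lie 'cV[F]_N) semidirect.
Proof.
refine (@LieHom _ (abelian_lie 'cV[F]_N) semidirect (fun v => (0, v)) _ _).
  by move=> a u v; congr pair; rewrite /= scaler0 addr0.
move=> u v; rewrite sd_lieE /= lie0l linear0 !mul0mx subrr.
by [].
Defined.

Definition sd_proj : lie_hom semidirect B :=
  @LieHom _ semidirect B fst (fun _ _ _ => erefl) (fun _ _ => erefl).

Definition sd_sec : lie_hom B semidirect.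
Proof.
refine (@LieHom _ B semidirect (fun b => (b, 0)) _ _).
  by move=> a u v; congr pair; rewrite /= scaler0 addr0.
by move=> u v; rewrite sd_lieE /= !mulmx0 subrr.
Defined.
End Semidirect.

(** * The one-dimensional Lie algebra *)

Section Line.
Variables (F : fieldType) (L : lieAlgType F).

Definition line : lieAlgType F := abelian_lie F^o.

Definition line_hom (x : L) : lie_hom line L.
Proof.
refine (@LieHom _ line L (fun a => (a : F) *: x) _ _).
  by move=> a u v /=; rewrite scalerDl scalerA.
move=> u v /=; rewrite abelian_lieE scale0r.
have -> (y : L) (a b : F) : lie (a *: y) (b *: y) = a *: (b *: lie y y).
  have := lie_linearl (b *: y) a y 0; rewrite lie0l !addr0 => ->.
  by have := lie_linearr y b y 0; rewrite lie0r !addr0 => ->.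
by rewrite lievv !scaler0.
Defined.

Lemma line_homE x (a : F) : line_hom x (a : line) = a *: x.
Proof. by []. Qed.
End Line.

Lemma solvable_semidirect_line (F : fieldType) (N : nat) (rho : lie_hom (line F) 'M[F]_N) :
  solvable_le 2 (semidirect rho).
Proof. by apply: solvable_semidirect => // x y z; rewrite abelian_lieE linear0 mul0mx. Qed.

(** * The Heisenberg algebra and its matrix representation *)

Section Heisenberg.
Variable F : fieldType.

(** Triples are coordinates in a basis x, y, z with z central and [x, y] = z. *)
Definition heis : Type := (F^o * F^o * F^o)%type.
HB.instance Definition _ := GRing.Lmodule.copy heis (F^o * F^o * F^o)%type.

Let heis_lie (x y : heis) : heis := (0, x.1.1 * y.1.2 - y.1.1 * x.1.2).

Let heis_lie_linearl y : linear (heis_lie^~ y).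
Proof.
move=> a u v; congr pair; rewrite /= ?scaler0 ?addr0 //.
by rewrite /GRing.scale /=; ring.
Qed.

Let heis_lie_linearr x : linear (heis_lie x).
Proof.
move=> a u v; congr pair; rewrite /= ?scaler0 ?addr0 //.
by rewrite /GRing.scale /=; ring.
Qed.

Let heis_lievv x : heis_lie x x = 0.
Proof. by congr pair; rewrite /= subrr. Qed.

Let heis_lie_jacobi x y z :
  heis_lie x (heis_lie y z) + heis_lie y (heis_lie z x) + heis_lie z (heis_lie x y) = 0.
Proof. by congr pair; rewrite /= !(mulr0, mul0r, subrr, addr0). Qed.

HB.instance Definition _ := Lmodule_isLieAlgebra.Build F heis
  heis_lie_linearl heis_lie_linearr heis_lievv heis_lie_jacobi.

Lemma heis_lieE (x y : heis) :
  lie x y = (0, x.1.1 * y.1.2 - y.1.1 * x.1.2) :> heis.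
Proof. by []. Qed.

Lemma heis_nilpotent (x y z : heis) : lie (lie x y) z = 0.
Proof. by rewrite heis_lieE /= !(mul0r, mulr0) subrr. Qed.

Variables (N : nat) (i j k : 'I_N).
Hypotheses (ij : i != j) (jk : j != k) (ik : i != k).

Let E (x : heis) : 'M[F]_N :=
  x.1.1 *: delta_mx i j + x.1.2 *: delta_mx j k + x.2 *: delta_mx i k.

(** Since [i], [j], [k] are distinct, e_ij e_jk = e_ik is the only nonzero product of two of the
    three elementary matrices. *)
Lemma heis_mx_mul (x y : heis) : E x *m E y = (x.1.1 * y.1.2) *: delta_mx i k.
Proof.
rewrite /E !mulmxDl !mulmxDr -!scalemxAl -!scalemxAr !mul_delta_mx_cond.
rewrite !eqxx !(eq_sym j i, eq_sym k j, eq_sym k i).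
by rewrite (negPf ij) (negPf jk) (negPf ik) !mulr0n !scaler0 !(addr0, add0r) scalerA.
Qed.

Definition heis_mx : lie_hom heis 'M[F]_N.
Proof.
refine (@LieHom _ heis 'M[F]_N E _ _).
  move=> a x y; rewrite /E /= !scalerDl !scalerDr !scalerA.
  by rewrite !addrA [LHS](ACl (1*3*5*2*4*6)%AC).
move=> x y; rewrite mx_lieE !heis_mx_mul /E heis_lieE /= !scale0r !add0r.
by rewrite scalerBl.
Defined.

Lemma heis_mxE x : heis_mx x = E x.
Proof. by []. Qed.

Lemma solvable_semidirect_heis : solvable_le 2 (semidirect heis_mx).
Proof.
apply: solvable_semidirect => [|x y z]; first exact: heis_nilpotent.
by rewrite heis_mx_mul heis_lieE mul0r scale0r.
Qed.
End Heisenberg.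

(** * Split extensions given by matrix actions *)

Section SolSplitExt.
Variables (F : fieldType) (n : nat).

Definition zero_lie_hom (L M : lieAlgType F) : lie_hom L M.
Proof.
refine (@LieHom _ L M (fun=> 0) _ _) => [a u v|u v].
  by rewrite scaler0 addr0.
by rewrite lie0l.
Defined.

Lemma sol_zero_morphism (A B : Sol F n) (f : hom A B) :
  is_zero_morphism f <-> forall x, (f : lie_hom _ _) x = 0.
Proof.
split=> [[Z [u [v [Z0 ->]]]] x|f0].
  (* On a zero object the identity and the zero map coincide by uniqueness, so every element of [Z]
     is 0. *)
  have [[w [_ wu]] _] := Z0 Z.
  have idE : lie_id (sval Z) = zero_lie_hom (sval Z) (sval Z).
    by rewrite -[LHS](wu _ I) -[RHS](wu _ I).
  have u0 : (u : lie_hom _ _) x = 0.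
    by rewrite -[LHS]/(lie_id (sval Z) (u x)) idE.
  by rewrite -[LHS]/((v : lie_hom _ _) ((u : lie_hom _ _) x)) u0 linear0.
(* Conversely, the space of columns of height 0 is a zero object through which [f] factors. *)
have uniq0 (x : abelian_lie 'cV[F]_0) : x = 0 by apply/matrixP=> -[].
have sZ : solvable_le n (abelian_lie 'cV[F]_0) by move=> x _; apply: uniq0.
exists (exist _ (abelian_lie 'cV[F]_0 : lieAlgType F) sZ).
exists (zero_lie_hom _ _), (zero_lie_hom _ _); split; last first.
  by apply: lie_homP => x; apply: f0.
move=> D; split; exists (zero_lie_hom _ _); split=> // g _.
  by apply: lie_homP => x; rewrite [RHS]uniq0.
by apply: lie_homP => x; rewrite (uniq0 x) !linear0.
Qed.

Variables (n2 : (2 <= n)%N) (N : nat).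

Definition sol_vec : Sol F n :=
  exist _ (abelian_lie 'cV[F]_N : lieAlgType F)
    (solvable_le_leq (ltnW n2) (@solvable_abelian F 'cV[F]_N)).

Section Ext.
Variables (B : Sol F n) (rho : lie_hom (sval B) 'M[F]_N).
Hypothesis sB : solvable_le 2 (semidirect rho).

Let sd : Sol F n :=
  exist _ (semidirect rho : lieAlgType F) (solvable_le_leq n2 sB).

Let sd_secK : (sd_proj rho : hom sd B) \oc (sd_sec rho : hom B sd) = idc B.
Proof. exact: lie_homP. Qed.

Let sd_kernel : is_kernel (sd_inj rho : hom sol_vec sd) (sd_proj rho : hom sd B).
Proof.
split=> [|W g /sol_zero_morphism g0]; first exact/sol_zero_morphism.
have g1 x : ((g : lie_hom _ _) x).1 = 0 := g0 x.
have hl : linear (fun x => ((g : lie_hom _ _) x).2 : abelian_lie 'cV[F]_N).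
  by move=> a x y; rewrite lie_hom_linear.
have hm : {morph (fun x => ((g : lie_hom _ _) x).2 : abelian_lie 'cV[F]_N) :
    x y / lie x y}.
  by move=> x y; rewrite lie_homM sd_lieE /= !g1 linear0 !mul0mx subrr.
exists (LieHom hl hm); split.
  by apply: lie_homP => x /=; rewrite [RHS]surjective_pairing g1.
by move=> h gE; apply: lie_homP => x /=; rewrite -gE.
Qed.

Definition sd_ext : split_ext B sol_vec := SplitExt sd_secK sd_kernel.
End Ext.

(** Pulling back along [f] restricts the action along [f]: the projection between the semidirect
    products applies [f] to the base part and keeps the vector part. *)
Lemma sd_ext_pull (B B' : Sol F n) (f : hom B' B)
    (rho : lie_hom (sval B) 'M[F]_N) (rho' : lie_hom (sval B') 'M[F]_N)
    (sB : solvable_le 2 (semidirect rho)) (sB' : solvable_le 2 (semidirect rho')) :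
  (forall b, rho' b = rho ((f : lie_hom _ _) b)) ->
  is_pullback_split_ext f (sd_ext sB) (sd_ext sB').
Proof.
move=> rhoE.
have pl : linear (fun x : semidirect rho' =>
    ((f : lie_hom _ _) x.1, x.2) : semidirect rho).
  by move=> a x y; congr pair; apply: lie_hom_linear.
have pm : {morph (fun x : semidirect rho' =>
    ((f : lie_hom _ _) x.1, x.2) : semidirect rho) : x y / lie x y}.
  by move=> x y; rewrite !sd_lieE /= lie_homM !rhoE.
exists (LieHom pl pm); split; last first.
- exact: lie_homP.
- by apply: lie_homP => x; rewrite /= linear0.
split; first exact: lie_homP.
move=> W u v uv.
have uvE w : ((u : lie_hom _ _) w).1 = (f : lie_hom _ _) ((v : lie_hom _ _) w) :=
  congr1 (fun h : lie_hom (sval W) (sval B) => h w) uv.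
have hl : linear (fun w => ((v : lie_hom _ _) w, ((u : lie_hom _ _) w).2)
    : semidirect rho').
  by move=> a x y; rewrite !lie_hom_linear.
have hm : {morph (fun w => ((v : lie_hom _ _) w, ((u : lie_hom _ _) w).2)
    : semidirect rho') : x y / lie x y}.
  by move=> x y; rewrite !lie_homM !sd_lieE /= !rhoE !uvE.
exists (LieHom hl hm); split.
  split; apply: lie_homP => w //=.
  by rewrite -uvE -surjective_pairing.
move=> h [hu hv]; apply: lie_homP => w /=.
by rewrite -hu -hv /= -surjective_pairing.
Qed.

(* Pulling back along 0 makes the section act trivially on the kernel. *)
Lemma sd_ext_pull0 (B : Sol F n) (rho : lie_hom (sval B) 'M[F]_N)
    (sB : solvable_le 2 (semidirect rho)) (E : split_ext B sol_vec) :
  split_ext_iso (sd_ext sB) E ->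
  is_pullback_split_ext (zero_lie_hom _ _ : hom B B) E (sd_ext sB) ->
  forall b, rho b = 0.
Proof.
move=> [t [[s [st _]] tk _ _]] [p [_ pk pb]] b.
have pkE v : (p : lie_hom _ _) (sd_inj rho v) = (t : lie_hom _ _) (sd_inj rho v).
  have /(congr1 (fun h : lie_hom _ _ => h v)) := etrans pk (esym tk).
  by [].
have p0 : (p : lie_hom _ _) (sd_sec rho b) = 0.
  have /(congr1 (fun h : lie_hom _ _ => h b)) := pb.
  by move=> /= ->; rewrite linear0.
have t_inj x : (t : lie_hom _ _) x = 0 -> x = 0.
  move=> tx; have /(congr1 (fun h : lie_hom _ _ => h x)) := st.
  by move=> /= <-; rewrite tx linear0.
suff kill (v : 'cV[F]_N) : rho b *m v = 0.
  by apply/matrixP=> i j; have /colP/(_ i) := kill (delta_mx j 0); rewrite -colE !mxE.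
(* In the semidirect product the bracket of [b] with [v] is [rho b *m v]. Its image under [p] is 0
   because [p] kills the section, while on the kernel [p] agrees with the injective [t]. *)
have := lie_homM p (sd_sec rho b) (sd_inj rho v).
rewrite p0 lie0l sd_lieE /= lie0r linear0 subr0.
by rewrite -[(0, _)]/(sd_inj rho (rho b *m v)) pkE => /t_inj [].
Qed.
End SolSplitExt.

(** * Contradiction with the solvability of the representing object *)

Theorem corollary3p2 (F : fieldType) (n : nat) (hn : (2 <= n)%N) :
  ~ weakly_action_representable (Sol F n) (Sol_has_pullbacks F n).
Proof.
(* This size makes both 0 and [2 ^ n] valid indices. *)
set N := (2 ^ n).+1.
move=> /(_ (sol_vec F hn N)) [T [tau [tau_nat tau_inj]]].
pose Lsol : Sol F n :=
  exist _ (line F) (solvable_le_leq (ltnW hn) (@solvable_abelian F F^o)).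
pose act (A : 'M[F]_N) := @sd_ext F n hn N Lsol _ (@solvable_semidirect_line F N (line_hom A)).
pose tau' B c : lie_hom (sval B) (sval T) := tau B c.
pose psi A : sval T := tau' Lsol (SplExt_class (act A)) (1 : F).
(* Naturality along the map from the line sending 1 to [b]: the value at [b] depends only on the
   matrix [rho b]. *)
have tauE (B : Sol F n) (rho : lie_hom (sval B) 'M[F]_N)
    (sB : solvable_le 2 (semidirect rho)) b :
    tau' B (SplExt_class (sd_ext hn sB)) b = psi (rho b).
  have /SplExt_pullE pullE : is_pullback_split_ext
      (line_hom b : hom Lsol B) (sd_ext hn sB) (act (rho b)).
    by apply: sd_ext_pull => a; rewrite !line_homE linearZ.
  by rewrite /psi /act -(pullE (Sol_has_pullbacks F n)) /tau' tau_nat /= scale1r.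
(* If [psi A] vanishes, [tau] sends the class of [act A] to the zero map, hence takes the same value
   on its pullback along 0; injectivity equates the two classes. *)
have psi_inj A : psi A = 0 -> A = 0.
  move=> psi0; set c := SplExt_class (act A).
  pose z : hom Lsol Lsol := zero_lie_hom _ _.
  have tau0 : tau' Lsol c = zero_lie_hom _ _.
    apply: lie_homP => a; rewrite -[a](mulr1 (a : F)).
    have -> : tau' Lsol c ((a : F) *: (1 : line F)) = (a : F) *: psi A by exact: linearZ.
    by rewrite psi0 scaler0.
  have /tau_inj : tau Lsol (SplExt_pull (Sol_has_pullbacks F n) z c) = tau Lsol c.
    rewrite tau_nat -[tau Lsol c]/(tau' Lsol c) tau0.
    exact: lie_homP.
  move=> /(congr1 (fun c => sval c (act A))) /= pullE.
  have [E [AE EA]] : SplExt_pull_class z c (act A).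
    by rewrite pullE; apply: split_ext_iso_refl.
  by have := sd_ext_pull0 AE EA (1 : F); rewrite line_homE scale1r.
pose e i k : 'M[F]_N := delta_mx (inord i) (inord k).
have psi_lie i j k : (i < j < k)%N -> (k < N)%N ->
    psi (e i k) = lie (psi (e i j)) (psi (e j k)).
  move=> /andP[ij jk] kN.
  (* The bound matters: [inord] sends out-of-range indices to a default, so distinctness could
     fail. *)
  have neq a b : (a < b < N)%N -> inord a != inord b :> 'I_N.
    by move=> /andP[ab bN]; rewrite -val_eqE /= !inordK; lia.
  have nij : inord i != inord j :> 'I_N by apply: neq; lia.
  have njk : inord j != inord k :> 'I_N by apply: neq; lia.
  have nik : inord i != inord k :> 'I_N by apply: neq; lia.
  have sH := @solvable_semidirect_heis F _ _ _ _ nij njk nik.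
  (* The section embeds the Heisenberg algebra into its semidirect product, which is already known
     to be metabelian. *)
  have sH' : solvable_le n (heis F).
    by apply: (solvable_le_leq hn) => h /(lie_hom_derived (sd_sec (heis_mx F nij njk nik)))/sH[].
  pose H : Sol F n := exist _ (heis F : lieAlgType F) sH'.
  pose x : heis F := (1, 0, 0); pose y : heis F := (0, 1, 0).
  have := lie_homM (tau' H (SplExt_class (@sd_ext F n hn N H _ sH))) x y.
  rewrite !tauE heis_lieE !heis_mxE /= !scale0r !scale1r !(addr0, add0r).
  by rewrite mulr1 mul0r subr0 scale1r.
have psi_der m i : (i + 2 ^ m < N)%N -> derived_series m (psi (e i (i + 2 ^ m)%N)).
  elim: m i => // m IH i iN.
  have p0 : (0 < 2 ^ m)%N by rewrite expn_gt0.
  rewrite expnS in iN *.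
  (* Splitting at the midpoint leaves two steps of length [2 ^ m], both covered by the induction
     hypothesis. *)
  rewrite (psi_lie i (i + 2 ^ m)%N); [|lia|lia].
  apply: lie_commutator_lie; first by apply: IH; lia.
  by have := IH (i + 2 ^ m)%N; rewrite -addnA addnn -mul2n; apply.
(* The n-th derived algebra of [T] is zero, so an elementary matrix would vanish, although its entry
   at (0, 2^n) is 1. *)
have /psi_inj/matrixP/(_ (inord 0) (inord (2 ^ n))) : psi (e 0 (0 + 2 ^ n))%N = 0.
  exact/(svalP T)/psi_der.
by rewrite !mxE !eqxx => /eqP; rewrite oner_eq0.
Qed.
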